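(* Let $\Lambda$ be a field and let $(M,\mu)$ be a graded associative $\Lambda$-algebra such that $Hoch^{n,2-n}(M,M)=0$ for all $n\geq 3$. Then any $A(\infty)$-algebra structure $\{m_i\}_{i\ge 1}$ on $M$ with $m_1=0$ and $m_2=\mu$ is equivalent to the trivial one, i.e. to the structure with $m_1=0$, $m_2=\mu$ and $m_i=0$ for all $i>2$.
   Context: Graded modules are $\mathbb{Z}$-graded $\Lambda$-modules $M=\sum_q M_q$; a graded associative algebra has a multiplication of degree $0$. For graded modules $A,N$, $Hom^k(\otimes^nA,N)$ is the set of $\Lambda$-linear maps $f:\otimes^nA\to N$ of degree $k$, i.e. $f(a_1\otimes\dots\otimes a_n)\in N_{q+k}$ with $q=\sum\dim a_i$. Tensor products of maps are evaluated by the Koszul rule $(f\otimes g)(x\otimes y)=(-1)^{\deg g\cdot\dim x}f(x)\otimes g(y)$; $1$ denotes the identity map and $1^r=1^{\otimes r}$. Hochschild cohomology: for a graded algebra $(A,\mu)$ put $C^{n,k}(A,A)=Hom^k(\otimes^nA,A)$, with coboundary $\delta:C^{n,k}(A,A)\to C^{n+1,k}(A,A)$, $$\delta f=\mu(1\otimes f)+\sum_{i=1}^{n}(-1)^i f(1^{i-1}\otimes\mu\otimes 1^{n-i})+(-1)^{n+1}\mu(f\otimes 1).$$ $Hoch^{n,k}(A,A)$ is the $n$-th homology module of $(C^{*,k}(A,A),\delta)$. An $A(\infty)$-algebra structure on a graded module $M$ is a sequence of $\Lambda$-linear maps $m_i:\otimes^iM\to M$, $i\ge1$, with $\deg m_i=2-i$,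 such that for every $n\ge1$ $$\sum_{r+s+t=n,\ s\ge1,\ r,t\ge 0}(-1)^{r+st}\,m_{r+1+t}(1^r\otimes m_s\otimes 1^t)=0.$$ A morphism of $A(\infty)$-algebras $(M,\{m_i\})\to(M',\{m'_i\})$ is a sequence of $\Lambda$-linear maps $f_i:\otimes^iM\to M'$, $i\ge1$, with $\deg f_i=1-i$, such that for every $n\ge 1$ $$\sum_{r+s+t=n,\ s\ge1,\ r,t\ge 0}(-1)^{r+st}f_{r+1+t}(1^r\otimes m_s\otimes1^t)=\sum_{u=1}^n\ \sum_{k_1+\dots+k_u=n,\ k_l\ge1}(-1)^{\sum_{l=1}^u(u-l)(k_l-1)}\,m'_u(f_{k_1}\otimes\dots\otimes f_{k_u}).$$ Two $A(\infty)$-structures $\{m_i\}$, $\{m'_i\}$ on $M$ with $m_1=m'_1=0$, $m_2=m'_2=\mu$ are equivalent if there is a morphism of $A(\infty)$-algebras $\{p_i\}:(M,\{m_i\})\to(M,\{m'_i\})$ with $p_1=\mathrm{id}$. *)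

(* Defs.v *)
From HB Require Import structures.
From mathcomp Require Import all_boot all_order all_algebra finmap.
Set Implicit Arguments.
Unset Strict Implicit.
Unset Printing Implicit Defensive.
Import Order.TTheory GRing.Theory Num.Theory.
Local Open Scope ring_scope.

(* The last two fields say that c |-> \sum_q c q, from finitely supported
   families with c q in M_q to M, is a bijection with inverse gcomp: M is the
   internal direct sum of the submodules M_q = homog q. *)
Record gradedMod (R : comNzRingType) := GradedMod {
  gcarrier :> lmodType R;
  homog : int -> submodClosed gcarrier;
  gcomp : gcarrier -> {fsfun int -> gcarrier with 0};
  gcomp_homog : forall x q, gcomp x q \in homog q;
  gcomp_sum : forall x, \sum_(q <- finsupp (gcomp x)) gcomp x q = x;
  gcomp_unique : forall c : {fsfun int -> gcarrier with 0},
    (forall q, c q \in homog q) ->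
    gcomp (\sum_(q <- finsupp c) c q) = c
}.

(* The linear extension of x |-> (-1)^(k * dim x); see ksign_homog. *)
Definition ksign (R : comNzRingType) (M : gradedMod R) (k : int) (x : M) : M :=
  \sum_(q <- finsupp (gcomp x)) (-1) ^+ absz (k * q) *: gcomp x q.

Lemma ksign_homog (R : comNzRingType) (M : gradedMod R) (k q : int) (x : M) :
  x \in homog M q -> ksign k x = (-1) ^+ absz (k * q) *: x.
Proof.
move=> xq; rewrite /ksign.
have gx : forall q', gcomp x q' = if q' == q then x else 0.
  pose c : {fsfun int -> M with 0} := [fsfun _ in [fset q]%fset => x].
  have cE q' : c q' = if q' == q then x else 0 by rewrite fsfunE inE.
  have cs : \sum_(j <- finsupp c) c j = x.
    rewrite (big_fset_incl _ (finsupp_sub _ _ _)) => [|j _ /fsfun_dflt->//].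
    by rewrite big_seq_fset1 cE eqxx.
  have ch q' : c q' \in homog M q'.
    by rewrite cE; case: eqP => [->//|_]; exact: rpred0.
  by move=> q'; rewrite -{1}cs (gcomp_unique ch).
have sub : (finsupp (gcomp x) `<=` [fset q])%fset.
  apply/fsubsetP=> j; rewrite mem_finsupp gx !inE.
  by case: (j == q) => //; rewrite eqxx.
rewrite (big_fset_incl _ sub) => [|j _ /fsfun_dflt->]; last exact: scaler0.
by rewrite big_seq_fset1 gx eqxx.
Qed.

(* Linear maps out of the n-th tensor power are represented by n-linear maps,
   i.e. by their values on the decomposable tensors a_1 (x) ... (x) a_n. *)
Definition multilinear (R : comNzRingType) (A N : lmodType R) (n : nat)
    (f : n.-tuple A -> N) : Prop :=
  forall (i : 'I_n) (a : n.-tuple A) (c : R) (x y : A),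
    let put z := [tuple if j == i then z else tnth a j | j < n] in
    f (put (c *: x + y)) = c *: f (put x) + f (put y).

Definition has_degree (R : comNzRingType) (A N : gradedMod R) (n : nat)
    (k : int) (f : n.-tuple A -> N) : Prop :=
  forall (d : n.-tuple int) (a : n.-tuple A),
    (forall i, tnth a i \in homog A (tnth d i)) ->
    f a \in homog N (\sum_(i < n) tnth d i + k).

(* f is an element of Hom^k(A^{(x) n}, N). *)
Definition is_Hom (R : comNzRingType) (A N : gradedMod R) (n : nat)
    (k : int) (f : n.-tuple A -> N) : Prop :=
  multilinear f /\ has_degree k f.

(* An n-ary map together with the degree that enters the Koszul signs. *)
Record gmap (R : comNzRingType) (A N : gradedMod R) := GMap {
  gdeg : int;
  garity : nat;
  gfun : garity.-tuple A -> N
}.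
Arguments GMap {R A N} gdeg {garity} gfun.

Definition gid (R : comNzRingType) (A : gradedMod R) : gmap A A :=
  GMap 0 (fun a : 1.-tuple A => thead a).
Arguments gid {R A}.

(* The value of f at a list of arguments, which avoids casts between equal
   arities; it is only used on lists of size n (otherwise it is 0). *)
Definition tapp (R : comNzRingType) (A N : gradedMod R) (n : nat)
    (f : n.-tuple A -> N) (s : seq A) : N :=
  if insub s is Some a then f a else 0.

(* (f_1 (x) ... (x) f_u)(a_1 (x) ... (x) a_n), by iterating the Koszul rule
   (f (x) G)(x (x) y) = (-1)^(deg G * dim x) f(x) (x) G(y), where
   G = f_2 (x) ... (x) f_u has degree deg f_2 + ... + deg f_u. *)
Fixpoint tens (R : comNzRingType) (A N : gradedMod R)
    (F : seq (gmap A N)) (a : seq A) : seq N :=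
  if F is f :: G then
    let k := \sum_(g <- G) gdeg g in
    let x := [seq ksign k z | z <- take (garity f) a] in
    tapp (@gfun _ _ _ f) x :: tens G (drop (garity f) a)
  else [::].

(* The composite f (F_1 (x) ... (x) F_u), of arity n, where u is the arity of f
   and n is the sum of the arities of the F_l. *)
Definition comp_tens (R : comNzRingType) (A N P : gradedMod R) (u n : nat)
    (f : u.-tuple N -> P) (F : seq (gmap A N)) (a : n.-tuple A) : P :=
  tapp f (tens F a).

(* 1^r (x) g (x) 1^t *)
Definition insertion (R : comNzRingType) (A : gradedMod R)
    (r : nat) (g : gmap A A) (t : nat) : seq (gmap A A) :=
  nseq r gid ++ g :: nseq t gid.

Definition graded_assoc_alg (R : comNzRingType) (M : gradedMod R)
    (mu : 2.-tuple M -> M) : Prop :=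
  is_Hom 0 mu /\ associative (fun x y => mu [tuple x; y]).

(* The Hochschild coboundary C^{n,k}(M, M) -> C^{n+1,k}(M, M). *)
Definition hoch_delta (R : comNzRingType) (M : gradedMod R)
    (mu : 2.-tuple M -> M) (n : nat) (k : int) (f : n.-tuple M -> M)
    (a : n.+1.-tuple M) : M :=
  comp_tens mu [:: gid; GMap k f] a
  + \sum_(1 <= i < n.+1)
      (-1) ^+ i *: comp_tens f (insertion i.-1 (GMap 0 mu) (n - i)) a
  + (-1) ^+ n.+1 *: comp_tens mu [:: GMap k f; gid] a.

Definition hoch_cocycle (R : comNzRingType) (M : gradedMod R)
    (mu : 2.-tuple M -> M) (n : nat) (k : int) (f : n.-tuple M -> M) : Prop :=
  is_Hom k f /\ forall a, hoch_delta mu k f a = 0.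

Definition hoch_coboundary (R : comNzRingType) (M : gradedMod R)
    (mu : 2.-tuple M -> M) (n : nat) (k : int) :
    (n.-tuple M -> M) -> Prop :=
  match n with
  | 0 => fun f => forall a, f a = 0
  | n'.+1 => fun f => exists2 g : n'.-tuple M -> M,
      is_Hom k g & forall a, f a = hoch_delta mu k g a
  end.

(* Hoch^{n,k}(M, M) = 0, where Hoch is cocycles modulo coboundaries. *)
Definition hoch_eq0 (R : comNzRingType) (M : gradedMod R)
    (mu : 2.-tuple M -> M) (n : nat) (k : int) : Prop :=
  forall f : n.-tuple M -> M, hoch_cocycle mu k f -> hoch_coboundary mu k f.

(* Sum over r + s + t = n, s >= 1, of
   (-1)^(r + s t) f_{r+1+t} (1^r (x) m_s (x) 1^t). *)
Definition insertion_sum (R : comNzRingType) (M N : gradedMod R)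
    (f : forall i : nat, i.-tuple M -> N) (m : forall i : nat, i.-tuple M -> M)
    (n : nat) (a : n.-tuple M) : N :=
  \sum_(r < n.+1) \sum_(s < n.+1)
    \sum_(t < n.+1 | (r + s + t == n)%N && (1 <= s)%N)
      (-1) ^+ (r + s * t) *:
        comp_tens (f (r + 1 + t)%N) (insertion r (GMap (2 - s%:Z) (m s)) t) a.

(* The operations m i are only meaningful for i >= 1: m 0 is unconstrained and
   never occurs in the relations. The same holds for morphisms. *)
Definition is_Ainf (R : comNzRingType) (M : gradedMod R)
    (m : forall i : nat, i.-tuple M -> M) : Prop :=
  (forall i, (1 <= i)%N -> is_Hom (2 - i%:Z) (m i)) /\
  (forall n, (1 <= n)%N -> forall a : n.-tuple M, insertion_sum m m a = 0).

(* The l-th block size k_l of the composition is tnth k (l - 1). *)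
Definition is_Ainf_morphism (R : comNzRingType) (M M' : gradedMod R)
    (m : forall i : nat, i.-tuple M -> M)
    (m' : forall i : nat, i.-tuple M' -> M')
    (f : forall i : nat, i.-tuple M -> M') : Prop :=
  (forall i, (1 <= i)%N -> is_Hom (1 - i%:Z) (f i)) /\
  (forall n, (1 <= n)%N -> forall a : n.-tuple M,
    insertion_sum f m a =
    \sum_(1 <= u < n.+1)
      \sum_(k : u.-tuple 'I_n.+1 |
              (\sum_(l < u) tnth k l == n)%N
              && [forall l : 'I_u, (1 <= tnth k l)%N])
        (-1) ^+ (\sum_(l < u) (u - l.+1) * (tnth k l - 1))%N *:
          comp_tens (m' u)
            [seq GMap (1 - (val j)%:Z) (f (val j)) | j : 'I_n.+1 <- k] a).

Definition Ainf_equiv (R : comNzRingType) (M : gradedMod R)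
    (mu : 2.-tuple M -> M) (m m' : forall i : nat, i.-tuple M -> M) : Prop :=
  [/\ is_Ainf m /\ is_Ainf m',
      (forall a, m 1%N a = 0) /\ (forall a, m' 1%N a = 0),
      (forall a, m 2%N a = mu a) /\ (forall a, m' 2%N a = mu a)
    & exists p : forall i : nat, i.-tuple M -> M,
        is_Ainf_morphism m m' p /\ (forall x, p 1%N [tuple x] = x)].

Definition trivial_Ainf (R : comNzRingType) (M : gradedMod R)
    (mu : 2.-tuple M -> M) (i : nat) : i.-tuple M -> M :=
  match i with
  | 2 => mu
  | _ => fun=> 0
  end.
Arguments trivial_Ainf {R M} mu i _.

(* Main.v *)
From Stdlib Require Import IndefiniteDescription.
Require Import Defs.
From mathcomp Require Import all_boot all_order all_algebra finmap ring zify.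
Set Implicit Arguments.
Unset Strict Implicit.
Unset Printing Implicit Defensive.
Import GRing.Theory.
Local Open Scope ring_scope.

(** Since the target has no operations besides mu, a morphism p from (M, m) to
    it amounts to a solution of one equation in the convolution algebra of maps
    from the tensor coalgebra of M to M: p D = p * p, where D is the bar
    differential of m and * is the convolution product built on mu. Such a p,
    with p_1 = id, is found one arity at a time by obstruction theory.

    Let phi = p D - p * p be the defect of an arbitrary p of the right degree.
    Then phi D + phi * p + p' * phi = 0, where p' is p twisted by a sign
    (D_defect). Indeed D D = 0 (bar_bar; these are the A-infinity relations), D
    is a coderivation (bar_splitsum), so that (p * p) D can be expanded, and mu
    is associative, so that the remaining triple products cancel (conv_assoc).
    If p is exact up to arity n, the part of this identity in arity n + 2 says
    that phi_(n+1) is a Hochschild cocycle of degree 2 - (n+1), because phi_k = 0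
    for k <= n, m_1 = 0, p_0 = 0 and p_1 = id (defect_cocycle). By hypothesis it
    is the coboundary of some g of arity n; adding g to p changes p in arity n
    only, keeps the defect zero up to arity n and subtracts the coboundary of g
    from phi_(n+1) (approx_step). Each arity is corrected only once, so the
    approximations have a limit (approx_limit).

    The tensor coalgebra is not constructed. A linear map on it is represented
    by a multilinear function of words (lists of elements of M), and
    precomposition with the coproduct and with D become the operations splitsum
    and bar on such functions, which satisfy recursions along the word.

    The signs are removed by suspending. With eps the involution that multiplies
    a homogeneous x by (-1)^(dim x), evaluating a map of arity n on the word
    (eps^(n-1) a_1, ..., eps a_(n-1), a_n), which is tw a, turns all the Koszul
    signs, and the signs in the A-infinity relations, into one rule: an operator
    of odd suspended degree that passes a letter replaces it by its image under
    sg = - eps. The lemmas insertion_sumE, trivial_compE and hoch_deltaE are the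
    dictionary between the two sides. *)

(** * Deconcatenation of words *)

Definition splitsum (T : Type) (V : zmodType) (H : seq T -> seq T -> V)
    (a : seq T) : V :=
  \sum_(i < (size a).+1) H (take i a) (drop i a).

Section SplitSum.
Variables (T : Type) (V : zmodType).
Implicit Types (H : seq T -> seq T -> V) (a : seq T).

Lemma splitsum_nil H : splitsum H [::] = H [::] [::].
Proof. by rewrite /splitsum big_ord1. Qed.

Lemma splitsum_cons H x a :
  splitsum H (x :: a) = H [::] (x :: a) + splitsum (fun b => H (x :: b)) a.
Proof. by rewrite /splitsum big_ord_recl /=. Qed.

Lemma eq_splitsum H H' a :
  (forall b c, a = b ++ c -> H b c = H' b c) -> splitsum H a = splitsum H' a.
Proof. by move=> eqH; apply: eq_bigr => i _; apply: eqH; rewrite cat_take_drop. Qed.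

Lemma splitsumD H H' a :
  splitsum (fun b c => H b c + H' b c) a = splitsum H a + splitsum H' a.
Proof. exact: big_split. Qed.

Lemma splitsum0 H a :
  (forall b c, a = b ++ c -> H b c = 0) -> splitsum H a = 0.
Proof. by move=> H0; apply: big1 => i _; rewrite H0 ?cat_take_drop. Qed.

Lemma splitsum_morph (W : zmodType) (L : V -> W) H a :
  L 0 = 0 -> {morph L : x y / x + y} ->
  splitsum (fun b c => L (H b c)) a = L (splitsum H a).
Proof. by move=> L0 LD; rewrite /splitsum (big_morph L LD L0). Qed.

(** Coassociativity of deconcatenation. *)
Lemma splitsumA (H : seq T -> seq T -> seq T -> V) a :
  splitsum (fun b c => splitsum (H b) c) a =
  splitsum (fun b c => splitsum (fun b1 b2 => H b1 b2 c) b) a.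
Proof.
elim: a H => [|x a IHa] H; first by rewrite !splitsum_nil.
rewrite !splitsum_cons splitsum_nil IHa -addrA; congr (_ + _).
by rewrite -splitsumD; apply: eq_splitsum => b c _; rewrite splitsum_cons.
Qed.

(** Together with splitsum_last, this isolates the extreme terms of a
    convolution product with a map that is zero on all words but long ones. *)
Lemma splitsum_first H x a :
  (forall b c, x :: a = b ++ c -> size b != 1%N -> H b c = 0) ->
  splitsum H (x :: a) = H [:: x] a.
Proof.
move=> H0; rewrite splitsum_cons H0 // add0r.
case: a H0 => [|y a] H0; first by rewrite splitsum_nil.
rewrite splitsum_cons splitsum0 ?addr0 // => b c E.
by rewrite H0 //= E.
Qed.

Lemma splitsum_last H a x :
  (forall b c, rcons a x = b ++ c -> size c != 1%N -> H b c = 0) ->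
  splitsum H (rcons a x) = H a [:: x].
Proof.
elim: a H => [|y a IHa] H H0 /=.
  by rewrite splitsum_cons splitsum_nil [X in _ + X]H0 ?addr0.
rewrite splitsum_cons H0 //= ?size_rcons // add0r IHa // => b c E.
by apply: H0; rewrite /= E.
Qed.

End SplitSum.

(** * Multilinear functions of words *)

Definition mlin (R : comNzRingType) (M N : lmodType R) (F : seq M -> N) :=
  forall b c k x y,
    F (b ++ (k *: x + y) :: c) = k *: F (b ++ x :: c) + F (b ++ y :: c).

Section Mlin.
Variables (R : comNzRingType) (M N : lmodType R).
Implicit Types (F : seq M -> N).

Lemma mlinD F b c x y : mlin F ->
  F (b ++ (x + y) :: c) = F (b ++ x :: c) + F (b ++ y :: c).
Proof. by move=> linF; have := linF b c 1 x y; rewrite !scale1r. Qed.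

Lemma mlin0 F b c : mlin F -> F (b ++ 0 :: c) = 0.
Proof. by move=> linF; apply: (addrI (F (b ++ 0 :: c))); rewrite -mlinD // !addr0. Qed.

Lemma mlinZ F b c k x : mlin F -> F (b ++ (k *: x) :: c) = k *: F (b ++ x :: c).
Proof. by move=> linF; have := linF b c k x 0; rewrite mlin0 // !addr0. Qed.

Lemma mlinN F b c x : mlin F -> F (b ++ (- x) :: c) = - F (b ++ x :: c).
Proof. by move=> linF; rewrite -scaleN1r mlinZ // scaleN1r. Qed.

Lemma mlin_cons F x : mlin F -> mlin (fun b => F (x :: b)).
Proof. by move=> linF b c k y z; exact: (linF (x :: b)). Qed.

Lemma mlin_map_scale F b c k : mlin F ->
  F (map ( *:%R k) b ++ c) = k ^+ size b *: F (b ++ c).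
Proof.
elim: b F => [|x b IHb] F linF /=; first by rewrite scale1r.
rewrite (mlinZ [::]) //= (IHb (fun b => F (x :: b))); last exact: mlin_cons.
by rewrite exprS scalerA.
Qed.

Lemma mlin_add F G : mlin F -> mlin G -> mlin (fun a => F a + G a).
Proof. by move=> lF lG b c k x y; rewrite lF lG scalerDr addrACA. Qed.

Lemma mlin_opp F : mlin F -> mlin (fun a => - F a).
Proof. by move=> lF b c k x y; rewrite lF opprD scalerN. Qed.

Lemma mlin_splitsum (H : seq M -> seq M -> N) :
  (forall c, mlin (fun b => H b c)) -> (forall b, mlin (H b)) ->
  mlin (splitsum H).
Proof.
move=> l1 l2 b; elim: b H l1 l2 => [|z b IHb] H l1 l2 c k x y /=.
  rewrite !splitsum_cons (l2 [::] [::]) scalerDr addrACA; congr (_ + _).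
  rewrite /splitsum scaler_sumr -big_split; apply: eq_bigr => i _ /=.
  exact: (l1 _ [::]).
rewrite !splitsum_cons (l2 [::] (z :: b)) (IHb (fun b => H (z :: b))) => [|d|d].
- by rewrite scalerDr addrACA.
- exact: (mlin_cons z (l1 d)).
- exact: l2.
Qed.

End Mlin.

(** * The bar differential *)

(** Precomposition with the coderivation of the tensor coalgebra that has
    corestriction m: the sum of F (s x_1, ..., s x_r, m c, e) over all ways of
    writing a as x_1 ... x_r c e with c nonempty. The recursion separates the
    terms where m takes the first letter from those where it does not. *)
Fixpoint bar (M : Type) (V : zmodType) (s : M -> M) (m : seq M -> M) (F : seq M -> V)
    (a : seq M) : V :=
  if a is x :: a' then
    splitsum (fun b c => F (m (x :: b) :: c)) a' +
    bar s m (fun b => F (s x :: b)) a'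
  else 0.

Section Bar.
Variables (M : Type) (V : zmodType) (s : M -> M).
Implicit Types (m : seq M -> M) (F G : seq M -> V) (H : seq M -> seq M -> V).

Lemma eq_bar m m' F F' a :
  (forall b c e, a = b ++ c ++ e -> (0 < size c)%N ->
     F (map s b ++ m c :: e) = F' (map s b ++ m' c :: e)) ->
  bar s m F a = bar s m' F' a.
Proof.
elim: a F F' => [|x a IHa] F F' eqF //=; congr (_ + _).
  by apply: eq_splitsum => b c E; apply: (eqF [::]); rewrite //= E.
by apply: IHa => b c e E c0; apply: (eqF (x :: b)); rewrite //= E.
Qed.

Lemma bar_morph (W : zmodType) (L : V -> W) m F a :
  L 0 = 0 -> {morph L : x y / x + y} ->
  bar s m (fun b => L (F b)) a = L (bar s m F a).
Proof.
by move=> L0 LD; elim: a F => [|x a IHa] F //=; rewrite LD IHa -splitsum_morph.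
Qed.

Lemma barD m F G a : bar s m (fun b => F b + G b) a = bar s m F a + bar s m G a.
Proof.
elim: a F G => [|x a IHa] F G /=; first by rewrite addr0.
by rewrite IHa splitsumD addrACA.
Qed.

Lemma barN m F a : bar s m (fun b => - F b) a = - bar s m F a.
Proof. by apply: (bar_morph (L := -%R)); [exact: oppr0 | exact: opprD]. Qed.

Lemma bar0 m F a :
  (forall b c e, a = b ++ c ++ e -> (0 < size c)%N ->
     F (map s b ++ m c :: e) = 0) -> bar s m F a = 0.
Proof.
move=> F0; rewrite (@eq_bar m m F (fun=> 0)) //.
by elim: a {F0} => //= x a ->; rewrite splitsum0 // addr0.
Qed.

(** The coderivation property: once m has merged a block into one letter, no cut
    goes through that block, so m acts inside one of the two factors. When it
    acts on the right factor, it passes all letters of the left one. *)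
Lemma bar_splitsum m H a :
  bar s m (splitsum H) a =
  splitsum (fun b c => bar s m (fun b' => H b' c) b +
                       bar s m (H (map s b)) c) a.
Proof.
elim: a H => [|x a IHa] H /=; first by rewrite splitsum_nil /= addr0.
rewrite splitsum_cons /= add0r.
under eq_splitsum => b c _ do rewrite splitsum_cons.
rewrite splitsumD splitsumA -!addrA; congr (_ + _).
under [in RHS]eq_splitsum => b c _ do rewrite -addrA.
rewrite splitsumD addrCA; congr (_ + _).
rewrite -IHa -barD.
by apply: eq_bar => b c e _ _; rewrite splitsum_cons.
Qed.

End Bar.

Section BarBar.
Variables (R : comNzRingType) (M N : lmodType R) (s : M -> M).

Lemma mlin_bar (m : seq M -> M) (F : seq M -> N) :
  (forall k x y, s (k *: x + y) = k *: s x + s y) ->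
  mlin m -> mlin F -> mlin (bar s m F).
Proof.
move=> ls lm lF b; elim: b F lF => [|z b IHb] F lF c k x y /=.
  rewrite scalerDr addrACA; congr (_ + _).
    rewrite /splitsum scaler_sumr -big_split; apply: eq_bigr => i _ /=.
    by rewrite (lm [::]) (lF [::]).
  rewrite -(@bar_morph _ _ _ _ ( *:%R k)) ?scaler0 //; last exact: scalerDr.
  by rewrite -barD; apply: eq_bar => d e f _ _; rewrite ls (lF [::]).
rewrite IHb; last exact: mlin_cons.
rewrite scalerDr addrACA; congr (_ + _).
apply: mlin_splitsum => d e f k' x' y'.
  by rewrite (lm (z :: e)) (lF [::]).
exact: (lF (_ :: e)).
Qed.

(** In the double application of the differential, two disjoint insertions of m
    occur in both orders and cancel because m anticommutes with s, while nested
    insertions add up to m applied to m, which vanishes. *)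
Lemma bar_bar (m : seq M -> M) (F : seq M -> N) a :
  involutive s -> (forall b, m (map s b) = - s (m b)) -> mlin F ->
  (forall b, bar s m m b = 0) ->
  bar s m (bar s m F) a = 0.
Proof.
move=> ss ms lF mm0; elim: a F lF => [|x a IHa] F lF //=.
have lFc y c : F ((- y) :: c) = - F (y :: c) := mlinN [::] c y lF.
rewrite barD IHa ?addr0; last by rewrite ss; exact: mlin_cons.
have cancel : splitsum (fun b => bar s m (fun c => F (m (s x :: map s b) :: c))) a
    = - splitsum (fun b => bar s m (fun c => F (s (m (x :: b)) :: c))) a.
  rewrite -(@splitsum_morph _ _ _ -%R) ?oppr0 //; last exact: opprD.
  apply: eq_splitsum => b c _; rewrite -barN.
  by apply: eq_bar => d e f _ _; rewrite -lFc -ms.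
rewrite bar_splitsum !splitsumD cancel splitsumA addrACA subrr addr0.
rewrite -splitsumD splitsum0 // => b c _.
have F0 : F (0 :: c) = 0 := mlin0 [::] c lF.
have FD : {morph (fun y => F (y :: c)) : y z / y + z}.
  by move=> y z; exact: (mlinD [::] c y z lF).
have := mm0 (x :: b) => /= /(congr1 (fun y => F (y :: c))).
by rewrite FD F0 -(splitsum_morph _ _ F0 FD) -(bar_morph _ _ _ _ F0 FD).
Qed.

End BarBar.

(** * Gradings and the parity involution *)

Lemma eq_signr (R : pzRingType) (m n : nat) :
  odd m = odd n -> (-1) ^+ m = (-1) ^+ n :> R.
Proof. by rewrite -(signr_odd R m) -(signr_odd R n) => ->. Qed.

Section Grading.
Variables (R : comNzRingType) (M : gradedMod R).
Implicit Types (x y : M) (a b c : seq M) (q : int).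

Lemma gcomp_lin k x y q : gcomp (k *: x + y) q = k *: gcomp x q + gcomp y q.
Proof.
pose A := (finsupp (gcomp x) `|` finsupp (gcomp y))%fset.
pose c : {fsfun int -> M with 0} :=
  [fsfun j in A => k *: gcomp x j + gcomp y j].
have cE j : c j = k *: gcomp x j + gcomp y j.
  rewrite fsfunE; case: ifPn => //; rewrite inE negb_or.
  by case/andP=> /fsfun_dflt-> /fsfun_dflt->; rewrite scaler0 addr0.
have cs : \sum_(j <- finsupp c) c j = k *: x + y.
  rewrite (big_fset_incl _ (finsupp_sub _ _ _)) => [|j _ /fsfun_dflt->//].
  rewrite (eq_bigr _ (fun j _ => cE j)) big_split -scaler_sumr /=.
  rewrite -(big_fset_incl _ (fsubsetUl _ _)) => [|j _ /fsfun_dflt->//].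
  rewrite -(big_fset_incl _ (fsubsetUr _ _)) => [|j _ /fsfun_dflt->//].
  by rewrite !gcomp_sum.
rewrite -cs gcomp_unique ?cE // => j; rewrite cE.
by apply: rpredD; [apply: rpredZ|]; exact: gcomp_homog.
Qed.

(** eps is the Koszul sign of an odd map passing x; sg is the same sign with
    the dimension of x shifted by one. *)
Definition eps x := ksign 1 x.
Definition sg x := - eps x.

Lemma ksign_lin k l x y : ksign k (l *: x + y) = l *: ksign k x + ksign k y.
Proof.
pose A := (finsupp (gcomp (l *: x + y)) `|`
  (finsupp (gcomp x) `|` finsupp (gcomp y)))%fset.
have kE z : (finsupp (gcomp z) `<=` A)%fset ->
    ksign k z = \sum_(j <- A) (-1) ^+ absz (k * j) *: gcomp z j.
  move=> sub; rewrite /ksign (big_fset_incl _ sub) // => j _ /fsfun_dflt->.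
  exact: scaler0.
rewrite !kE ?fsubsetUl //; last 2 first.
- by rewrite fsubsetU // fsubsetUr orbT.
- by rewrite fsubsetU // fsubsetUl orbT.
rewrite scaler_sumr -big_split; apply: eq_bigr => j _ /=.
by rewrite gcomp_lin scalerDr !scalerA mulrC.
Qed.

Lemma ksignD k : {morph @ksign R M k : x y / x + y}.
Proof. by move=> x y; have := ksign_lin k 1 x y; rewrite !scale1r. Qed.

Lemma ksign0 k : ksign k (0 : M) = 0.
Proof. by apply: (addrI (ksign k 0)); rewrite -ksignD !addr0. Qed.

Lemma homog_ind (P : M -> Prop) :
  (forall x y, P x -> P y -> P (x + y)) -> P 0 ->
  (forall q x, x \in homog M q -> P x) -> forall x, P x.
Proof.
move=> PD P0 Ph x; rewrite -(gcomp_sum x).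
by elim/big_ind: _ => // q _; apply: (Ph q); exact: gcomp_homog.
Qed.

Lemma eps_homog q x : x \in homog M q -> eps x = (-1) ^+ absz q *: x.
Proof. by move=> /(ksign_homog 1); rewrite mul1r. Qed.

Lemma eps_lin k x y : eps (k *: x + y) = k *: eps x + eps y.
Proof. exact: ksign_lin. Qed.

Lemma epsZ k x : eps (k *: x) = k *: eps x.
Proof. by have := eps_lin k x 0; rewrite /eps ksign0 !addr0. Qed.

Lemma epsN x : eps (- x) = - eps x.
Proof. by rewrite -scaleN1r epsZ scaleN1r. Qed.

Lemma eps0 : eps 0 = 0.
Proof. exact: ksign0. Qed.

Lemma epsD : {morph eps : x y / x + y}.
Proof. exact: ksignD. Qed.

Lemma epsK : involutive eps.
Proof.
elim/homog_ind => [x y Ex Ey||q x xq]; rewrite ?eps0 //.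
  by rewrite !epsD Ex Ey.
rewrite (eps_homog xq) epsZ (eps_homog xq) scalerA -exprD addnn -signr_odd.
by rewrite odd_double scale1r.
Qed.

(** Every Koszul sign is thereby a power of one involution. *)
Lemma ksignE k x : ksign k x = iter (absz k) eps x.
Proof.
elim/homog_ind: x => [x y Ex Ey||q x xq].
- by rewrite ksignD Ex Ey; elim: `|k|%N => //= n <-; rewrite epsD.
- by rewrite ksign0; elim: `|k|%N => //= n <-; rewrite eps0.
rewrite (ksign_homog _ xq) abszM mulnC.
elim: `|k|%N => [|n /= <-]; first by rewrite muln0 scale1r.
by rewrite mulnS exprD -scalerA epsZ (eps_homog xq) !scalerA mulrC.
Qed.

Lemma sgK : involutive sg.
Proof. by move=> x; rewrite /sg epsN opprK epsK. Qed.

Lemma sg_lin k x y : sg (k *: x + y) = k *: sg x + sg y.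
Proof. by rewrite /sg eps_lin opprD scalerN. Qed.

Lemma eps_in q x : (eps x \in homog M q) = (x \in homog M q).
Proof.
suff H y : y \in homog M q -> eps y \in homog M q.
  by apply/idP/idP=> /H //; rewrite epsK.
by move=> yq; rewrite (eps_homog yq) rpredZ.
Qed.

Lemma homogN q x : x \in homog M q -> - x \in homog M q.
Proof. by move=> xq; rewrite -scaleN1r rpredZ. Qed.

Lemma sg_in q x : x \in homog M q -> sg x \in homog M q.
Proof. by move=> xq; apply: homogN; rewrite eps_in. Qed.

Lemma iter_eps_in n q x : (iter n eps x \in homog M q) = (x \in homog M q).
Proof. by elim: n => //= n IHn; rewrite eps_in. Qed.

Lemma iter_eps_lin n k x y :
  iter n eps (k *: x + y) = k *: iter n eps x + iter n eps y.
Proof. by elim: n => //= n ->; exact: eps_lin. Qed.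

Lemma iter_epsZ n k x : iter n eps (k *: x) = k *: iter n eps x.
Proof. by elim: n => //= n ->; exact: epsZ. Qed.

Lemma iter_eps_odd n x : iter (odd n) eps x = iter n eps x.
Proof. by elim: n => //= n <-; case: (odd n) => //=; rewrite epsK. Qed.

Lemma iter_epsK n : involutive (iter n eps).
Proof. by move=> x; rewrite -iterD -iter_eps_odd oddD addbb. Qed.

(** D is the total degree of the word in the tensor powers of the suspension
    of M, where an element of M_q has degree q - 1. *)
Inductive homw : seq M -> int -> Prop :=
| homw_nil : homw [::] 0
| homw_cons x q a D : x \in homog M q -> homw a D -> homw (x :: a) (q - 1 + D).

(** Degree with respect to that shifted grading of words: a family of maps F_n
    of degree c - n in each arity n has the single degree c. Thus A-infinity
    operations have degree 2 and the components of a morphism degree 1. *)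
Definition sdegree (c : int) (F : seq M -> M) :=
  forall a D, homw a D -> F a \in homog M (D + c).

Lemma homw_consE x a D : homw (x :: a) D ->
  exists q D', [/\ x \in homog M q, homw a D' & D = q - 1 + D'].
Proof.
by move=> h; inversion h as [|y q b E yq hb]; subst; exists q, E.
Qed.

Lemma homw_cat b c D : homw (b ++ c) D ->
  exists D1 D2, [/\ homw b D1, homw c D2 & D = D1 + D2].
Proof.
elim: b D => [|x b IHb] D /=.
  by exists 0, D; split=> //; [exact: homw_nil | rewrite add0r].
case/homw_consE=> q [D' [xq /IHb[D1 [D2 [h1 h2 ->]]] ->]].
by exists (q - 1 + D1), D2; rewrite addrA; split=> //; exact: homw_cons.
Qed.

Lemma homw_catI b c D1 D2 : homw b D1 -> homw c D2 -> homw (b ++ c) (D1 + D2).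
Proof.
elim=> [|x q a D xq _ IH] hc; first by rewrite add0r.
by rewrite -addrA; apply: homw_cons => //; exact: IH.
Qed.

(** Letter by letter, each entry is the sum of its homogeneous components. *)
Lemma mlin_homw_ext (F G : seq M -> M) : mlin F -> mlin G ->
  (forall a D, homw a D -> F a = G a) -> F =1 G.
Proof.
move=> lF lG FG a; rewrite -[a]/([::] ++ a).
elim: a [::] 0 homw_nil => [|x a IHa] b D hb; first by rewrite cats0; exact: FG hb.
elim/homog_ind: x => [x y Ex Ey||q x xq]; first by rewrite !mlinD // Ex Ey.
  by rewrite !mlin0.
rewrite -cat_rcons; apply: (IHa _ (D + (q - 1 + 0))).
by rewrite -cats1; apply: homw_catI => //; apply: homw_cons => //; exact: homw_nil.
Qed.

Lemma mlin_map (f : M -> M) (F : seq M -> M) :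
  (forall k x y, f (k *: x + y) = k *: f x + f y) -> mlin F ->
  mlin (fun a => F (map f a)).
Proof. by move=> lf lF b c k x y; rewrite !map_cat /= lf lF. Qed.

Lemma mlin_eps (F : seq M -> M) : mlin F -> mlin (fun a => eps (F a)).
Proof. by move=> lF b c k x y; rewrite lF eps_lin. Qed.

Lemma mlin_scale l (F : seq M -> M) : mlin F -> mlin (fun a => l *: F a).
Proof. by move=> lF b c k x y; rewrite lF scalerDr !scalerA mulrC. Qed.

Lemma map_sg_homw a D (F : seq M -> M) : mlin F -> homw a D ->
  F (map sg a) = (-1) ^+ absz D *: F a.
Proof.
move=> lF h; elim: h F lF => [|x q b E xq _ IH] F lF /=; first by rewrite scale1r.
rewrite /sg (eps_homog xq) -scaleN1r scalerA (mlinZ [::]) //=.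
rewrite (IH (fun b => F (x :: b))); last exact: mlin_cons.
rewrite scalerA -exprS -exprD; congr (_ *: _).
by apply: eq_signr; lia.
Qed.

(** On homogeneous words both sides are F a up to a sign. In particular a
    map of degree 1 commutes with sg and one of degree 2 anticommutes with it. *)
Lemma map_sg (c : nat) (F : seq M -> M) a : mlin F -> sdegree c F ->
  F (map sg a) = (-1) ^+ c *: eps (F a).
Proof.
move=> lF dF; move: a; apply: mlin_homw_ext => [||a D h].
- exact/mlin_map/lF/sg_lin.
- exact/mlin_scale/mlin_eps.
rewrite (map_sg_homw lF h) (eps_homog (dF _ _ h)) scalerA -exprD.
by congr (_ *: _); apply: eq_signr; lia.
Qed.

Lemma map_iter_eps (c : nat) (F : seq M -> M) n a : mlin F -> sdegree c F ->
  F (map (iter n eps) a) = (-1) ^+ (n * (size a + c)) *: iter n eps (F a).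
Proof.
move=> lF dF; elim: n => [|n IHn] /=; first by rewrite map_id mul0n scale1r.
have -> : map (fun x => eps (iter n eps x)) a =
    map ( *:%R (-1)) (map sg (map (iter n eps) a)) ++ [::].
  by rewrite cats0 -!map_comp; apply: eq_map => x /=; rewrite scaleN1r opprK.
rewrite (mlin_map_scale _ _ _ lF) cats0 (map_sg _ lF dF) IHn epsZ !scalerA !size_map.
by rewrite -!exprD mulSn.
Qed.

Lemma sdegree_bar (e : int) m F :
  sdegree 2 m -> sdegree e F -> sdegree (e + 1) (bar sg m F).
Proof.
move=> dm dF a D h; elim: h e F dF => [|x q b E xq hb IH] e F dF /=.
  exact: rpred0.
apply: rpredD.
  apply: rpred_sum => i _; move: hb; rewrite -{1}(cat_take_drop i b).
  case/homw_cat=> D1 [D2 [h1 h2 ->]].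
  have := dF _ _ (homw_cons (dm _ _ (homw_cons xq h1)) h2).
  by apply: etrans; congr (_ \in homog M _); ring.
have -> : q - 1 + E + (e + 1) = E + (q - 1 + e + 1) by ring.
apply: IH => d D' hd; have := dF _ _ (homw_cons _ hd).
rewrite addrA [D' + _]addrC; apply; exact: sg_in.
Qed.

End Grading.

Arguments eps {R M} x.
Arguments sg {R M} x.

(** * Suspension of multilinear maps *)

Section Twist.
Variables (R : comNzRingType) (M : gradedMod R).
Implicit Types (x y : M) (a b c : seq M).

Lemma eq_iter_eps m n x : odd m = odd n -> iter m eps x = iter n eps x.
Proof. by rewrite -(iter_eps_odd m) -(iter_eps_odd n) => ->. Qed.

(** The sign of the isomorphism between the n-th tensor power of the suspension
    of M and the suspended n-th tensor power of M: the n - j suspensions on the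
    right of the j-th letter pass over it. *)
Fixpoint tw a : seq M :=
  if a is x :: a' then iter (size a') eps x :: tw a' else [::].

Lemma size_tw a : size (tw a) = size a.
Proof. by elim: a => //= x a ->. Qed.

Lemma tw_cat a b : tw (a ++ b) = map (iter (size b) eps) (tw a) ++ tw b.
Proof. by elim: a => //= x a ->; rewrite size_cat addnC iterD. Qed.

Lemma tw_map_iter n a : tw (map (iter n eps) a) = map (iter n eps) (tw a).
Proof. by elim: a => //= x a ->; rewrite size_map -!iterD addnC. Qed.

Lemma twK : involutive tw.
Proof. by elim=> //= x a ->; rewrite size_tw iter_epsK. Qed.

Lemma homw_tw a D : homw a D -> homw (tw a) D.
Proof. by elim=> [|x q b E xq _ IH]; constructor; rewrite ?iter_eps_in. Qed.

Lemma mlin_tw (N : lmodType R) (F : seq M -> N) : mlin F -> mlin (fun a => F (tw a)).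
Proof. by move=> lF b c k x y; rewrite !tw_cat /= iter_eps_lin lF. Qed.

Lemma sdegree_tw e (F : seq M -> M) : sdegree e F -> sdegree e (fun a => F (tw a)).
Proof. by move=> dF a D /homw_tw/dF. Qed.

End Twist.

Section Tuples.
Variables (R : comNzRingType) (M : gradedMod R).
Implicit Types (x y : M) (a b c : seq M).

Lemma tapp_tuple (N : gradedMod R) n (f : n.-tuple M -> N) (t : n.-tuple M) :
  tapp f t = f t.
Proof. by rewrite /tapp valK. Qed.

Lemma tapp_out (N : gradedMod R) n (f : n.-tuple M -> N) a :
  size a <> n -> tapp f a = 0.
Proof. by move=> an; rewrite /tapp insubN //; apply/eqP. Qed.

Lemma tapp_tw (F : seq M -> M) n (f : n.-tuple M -> M) a :
  (forall t, f t = F (tw t)) -> size a = n -> tapp f a = F (tw a).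
Proof.
by move=> fF /eqP sa; rewrite -[a]/(val (Tuple sa)) tapp_tuple fF.
Qed.

(** Links the replacement of an entry of a tuple in multilinear with the
    substitution of a letter of a word in mlin. *)
Lemma put_cat n (t : n.-tuple M) b c x (i : 'I_n) z :
  tval t = b ++ x :: c -> val i = size b ->
  [seq (if j == i then z else tnth t j) | j <- enum 'I_n] = b ++ z :: c.
Proof.
move=> tE iE; have sE : n = size (b ++ z :: c).
  by rewrite -(size_tuple t) tE !size_cat.
apply: (@eq_from_nth _ 0); rewrite size_map size_enum_ord // => j jn.
rewrite (nth_map i) ?size_enum_ord // -val_eqE /= (tnth_nth 0) tE.
rewrite nth_enum_ord // iE !nth_cat.
case: ltngtP => //= [bj|->]; last by rewrite subnn.
by case: (j - size b)%N (subn_gt0 (size b) j) => //; rewrite bj.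
Qed.

Lemma mlin_tapp n (f : n.-tuple M -> M) : multilinear f -> mlin (tapp f).
Proof.
move=> lf b c k x y.
have [sE|sN] := eqVneq (size (b ++ x :: c)) n; last first.
  by rewrite !tapp_out ?scaler0 ?addr0 // => E; move: sN; rewrite -E !size_cat eqxx.
have tP z : size (b ++ z :: c) == n by rewrite -sE !size_cat.
have ib : (size b < n)%N by rewrite -sE size_cat /= addnS ltnS leq_addr.
have := lf (Ordinal ib) (Tuple (tP x)) k x y; rewrite /= -!tapp_tuple /=.
by rewrite !(@put_cat _ (Tuple (tP x)) b c x).
Qed.

Lemma multilinear_mlin n (F : seq M -> M) (f : n.-tuple M -> M) :
  (forall t, f t = F t) -> mlin F -> multilinear f.
Proof.
move=> fF lF i t k x y /=; rewrite !fF /=.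
have tE : tval t = take i t ++ tnth t i :: drop i.+1 t.
  by rewrite (tnth_nth 0) -drop_nth ?cat_take_drop ?size_tuple.
have iE : val i = size (take i t) by rewrite size_takel // size_tuple ltnW.
by rewrite !(put_cat _ tE iE) lF.
Qed.

Lemma homwP a D : homw a D <-> exists ds : seq int,
  [/\ size ds = size a, forall i, (i < size a)%N -> nth 0 a i \in homog M (nth 0 ds i)
    & D = \sum_(d <- ds) d - (size a)%:Z].
Proof.
split; first elim=> [|x q b E xq _ [ds [sE dsP ->]]].
- by exists [::]; rewrite big_nil.
- exists (q :: ds); rewrite /= sE; split=> // [[|i] //=|]; first exact: dsP.
  by rewrite big_cons; lia.
elim: a D => [|x a IHa] D [[|q ds] [] //= sE dsP ->].
  by rewrite big_nil; exact: homw_nil.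
have -> : \sum_(d <- q :: ds) d - (size a).+1%:Z =
    q - 1 + (\sum_(d <- ds) d - (size a)%:Z).
  by rewrite big_cons /=; lia.
apply: homw_cons; first exact: (dsP 0%N).
apply: IHa; exists ds; split=> //; first by case: sE.
by move=> i; apply: (dsP i.+1).
Qed.

Lemma sdegree_tapp (e : int) n (f : n.-tuple M -> M) :
  has_degree (e - n%:Z) f -> sdegree e (tapp f).
Proof.
move=> df a D /homwP[ds [sds dsP ->]].
have [sa|/eqP sa] := eqVneq (size a) n; last by rewrite tapp_out // rpred0.
have at_ : size a == n by apply/eqP.
have dt : size ds == n by rewrite sds.
have := df (Tuple dt) (Tuple at_); rewrite -tapp_tuple /=.
rewrite -(big_tuple _ _ (Tuple dt) xpredT id) /= sa.
have -> : \sum_(d <- ds) d - n%:Z + e = \sum_(d <- ds) d + (e - n%:Z) by lia.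
by apply=> i; rewrite !(tnth_nth 0); apply: dsP; rewrite sa.
Qed.

Lemma has_degree_sdegree (e : int) n (F : seq M -> M) (f : n.-tuple M -> M) :
  (forall t, f t = F t) -> sdegree e F -> has_degree (e - n%:Z) f.
Proof.
move=> fF dF d t td; rewrite fF -(big_tuple _ _ d xpredT id).
have -> : \sum_(j <- d) j + (e - n%:Z) = \sum_(j <- d) j - n%:Z + e by lia.
apply: dF; apply/homwP; exists d; rewrite !size_tuple; split=> // i ilt.
by have := td (Ordinal ilt); rewrite !(tnth_nth 0).
Qed.

(** The map on tensor powers of the suspension of M that corresponds to f. *)
Definition susp n (f : n.-tuple M -> M) a : M := tapp f (tw a).

Lemma mlin_susp n (f : n.-tuple M -> M) : multilinear f -> mlin (susp f).
Proof. by move=> lf; exact/mlin_tw/mlin_tapp. Qed.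

Lemma sdegree_susp (e : int) n (f : n.-tuple M -> M) :
  has_degree (e - n%:Z) f -> sdegree e (susp f).
Proof. by move=> df; exact/sdegree_tw/sdegree_tapp. Qed.

Lemma susp_out n (f : n.-tuple M -> M) a : size a <> n -> susp f a = 0.
Proof. by move=> sa; rewrite /susp tapp_out // size_tw. Qed.

Lemma is_Hom_tw (e : int) n (F : seq M -> M) (f : n.-tuple M -> M) :
  (forall t, f t = F (tw t)) -> mlin F -> sdegree e F -> is_Hom (e - n%:Z) f.
Proof.
move=> fF lF dF; split.
  exact: (multilinear_mlin fF (mlin_tw lF)).
exact: (has_degree_sdegree fF (sdegree_tw dF)).
Qed.

End Tuples.

(** * Dictionary between the signed and the suspended formulas *)

Section Bridge.
Variables (R : comNzRingType) (M : gradedMod R).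
Implicit Types (x y : M) (a b c : seq M) (F : seq M -> M).

Lemma map_ksign0 a : map (ksign 0) a = a.
Proof. by rewrite -[RHS]map_id; apply: eq_map => x; rewrite ksignE. Qed.

Lemma tapp_gid x : tapp (@gfun _ _ _ (@gid R M)) [:: x] = x.
Proof. by rewrite /tapp insubT. Qed.

Lemma tens_gid t a : size a = t -> tens (nseq t (@gid R M)) a = a.
Proof.
elim: t a => [|t IHt] [|x a] //= [sa].
by rewrite take0 drop0 /= IHt // big_nseq iter_fix ?addr0 // ksignE tapp_gid.
Qed.

Lemma tens_insertion r (g : gmap M M) t a :
  size a = (r + garity g + t)%N ->
  tens (insertion r g t) a =
  map (iter (absz (gdeg g)) eps) (take r a) ++
    tapp (@gfun _ _ _ g) (take (garity g) (drop r a)) :: drop (r + garity g) a.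
Proof.
have sum0 : \sum_(h <- nseq t (@gid R M)) gdeg h = 0.
  by rewrite big_nseq iter_fix ?addr0.
have sumg r' : \sum_(h <- insertion r' g t) gdeg h = gdeg g.
  by elim: r' => [|r' IHr]; rewrite /insertion /= big_cons ?sum0 ?addr0 // IHr add0r.
elim: r a => [|r IHr] a sa.
  rewrite /insertion /= take0 drop0 sum0 map_ksign0 tens_gid //.
  by rewrite size_drop sa addKn.
case: a sa => [|x a] //= [sa]; rewrite -/(insertion r g t) sumg take0 drop0 IHr //.
by rewrite ksignE tapp_gid.
Qed.

(** The recursion of bar, unfolded into a sum over the position r and the
    length l of the block on which m acts. *)
Lemma bar_sum (s : M -> M) (m : seq M -> M) F a :
  bar s m F a =
  \sum_(r < (size a).+1) \sum_(l < (size a).+1 | (r + l <= size a)%N && (0 < l)%N)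
    F (map s (take r a) ++ m (take l (drop r a)) :: drop (r + l) a).
Proof.
elim: a F => [|x a IHa] F /=.
  by rewrite big_ord1 big_pred0 // => -[[|i] //=].
rewrite big_ord_recl /=; congr (_ + _).
  rewrite big_mkcond big_ord_recl /= add0r; apply: eq_bigr => i _.
  by rewrite /bump /= add0n add1n ltn_ord.
rewrite IHa; apply: eq_bigr => r _.
rewrite [LHS]big_mkcond [RHS]big_mkcond [RHS]big_ord_recr /= /bump add1n.
rewrite addSn ltnS addnS ltnNge leq_addl /= addr0; apply: eq_bigr => l _ /=.
by rewrite addSn ltnS.
Qed.

(** The letters of B pass an operation of parity n, then size S and size C many
    suspensions, and finally the size C + 1 suspensions on their right after the
    insertion; n and size S have the same parity, so that only eps remains. The
    sign on the left turns this into sg on B and makes up for moving m past the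
    suspensions of C. *)
Lemma insertion_term F (m : seq M -> M) n B S C :
  mlin F -> mlin m -> sdegree 2 m -> odd n = odd (size S) ->
  let a := tw (B ++ S ++ C) in
  (-1) ^+ (size B + size S * size C) *:
    F (tw (map (iter n eps) (take (size B) a) ++
       m (tw (take (size S) (drop (size B) a))) :: drop (size B + size S) a)) =
  F (map sg B ++ m S :: C).
Proof.
move=> lF lm dm nS /=; rewrite !tw_cat (addnC (size B) (size S)) -drop_drop.
rewrite take_size_cat ?drop_size_cat ?size_map ?size_tw //.
rewrite take_size_cat ?drop_size_cat ?size_map ?size_tw //.
rewrite /= !tw_map_iter !twK size_tw -!map_comp.
(* m passes the suspensions of the letters of C *)
rewrite (map_iter_eps _ _ lm (dm : sdegree 2%N m)) iter_epsZ iter_epsK mlinZ //.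
have -> : map (iter (size C).+1 eps \o
   (iter n eps \o iter (size (S ++ C)) eps)) B =
   map ( *:%R (-1)) (map sg B).
  rewrite -map_comp; apply: eq_map => x; rewrite /= scaleN1r opprK.
  rewrite -!iterD -[LHS]iterS; apply: (@eq_iter_eps _ _ _ 1).
  by rewrite size_cat; lia.
rewrite mlin_map_scale // !scalerA -!exprD size_map -[RHS]scale1r.
by congr (_ *: _); apply: (@eq_signr _ _ 0); lia.
Qed.

Lemma comp_insertion u s (f : u.-tuple M -> M) (g : s.-tuple M -> M)
    F (mt : seq M -> M) k n (a : n.-tuple M) r t :
  (forall v, f v = F (tw v)) -> (forall v, g v = mt (tw v)) ->
  mlin F -> mlin mt -> sdegree 2 mt -> odd (absz k) = odd s ->
  u = (r + 1 + t)%N -> n = (r + s + t)%N ->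
  (-1) ^+ (r + s * t) *: comp_tens f (insertion r (GMap k g) t) a =
  F (map sg (take r (tw a)) ++
     mt (take s (drop r (tw a))) :: drop (r + s) (tw a)).
Proof.
move=> fF gF lF lm dm ks uE nE.
have sb : size (tw a) = n by rewrite size_tw size_tuple.
set b := tw a in sb *.
have aE : tval a = tw b by rewrite twK.
have bE : b = take r b ++ take s (drop r b) ++ drop (r + s) b.
  by rewrite addnC -drop_drop !cat_take_drop.
have sB : size (take r b) = r by rewrite size_takel // sb; lia.
have sS : size (take s (drop r b)) = s by rewrite size_takel // size_drop sb; lia.
have sC : size (drop (r + s) b) = t by rewrite size_drop sb; lia.
have kS : odd (absz k) = odd (size (take s (drop r b))) by rewrite sS.
have := insertion_term (take r b) (drop (r + s) b) lF lm dm kS.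
rewrite /= -bE sB sS sC => <-; congr (_ *: _).
rewrite /comp_tens tens_insertion /= ?size_tuple //.
rewrite (tapp_tw fF); last first.
  by rewrite size_cat size_map /= size_drop size_takel ?size_tuple; lia.
rewrite (tapp_tw gF) ?aE //.
by rewrite size_takel // size_drop size_tw sb; lia.
Qed.

(** In suspended form the left-hand sides of the relations of an A-infinity
    algebra, and of a morphism, are the bar differential. *)
Lemma insertion_sumE (f m : forall i : nat, i.-tuple M -> M) F (mt : seq M -> M)
    n (a : n.-tuple M) :
  (forall i (t : i.-tuple M), (0 < i)%N -> f i t = F (tw t)) ->
  (forall i (t : i.-tuple M), (0 < i)%N -> m i t = mt (tw t)) ->
  mlin F -> mlin mt -> sdegree 2 mt ->
  insertion_sum f m a = bar sg mt F (tw a).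
Proof.
move=> fF mF lF lm dm; rewrite bar_sum size_tw size_tuple.
apply: eq_bigr => r _; rewrite [RHS]big_mkcond; apply: eq_bigr => s _ /=.
case: ifPn => [/andP[rsn s0]|rsn]; last first.
  by apply: big1 => t /andP[/eqP E s0]; exfalso; move: rsn; rewrite s0 andbT; lia.
have tn : (n - (r + s) < n.+1)%N by rewrite ltnS leq_subr.
rewrite (big_pred1 (Ordinal tn)) => [|t /=]; last first.
  by rewrite s0 andbT -val_eqE /= -[X in _ == X](subnKC rsn) eqn_add2l.
apply: (@comp_insertion _ _ _ _ F mt) => //.
- by move=> b; apply: fF; rewrite addn1.
- by move=> b; apply: mF.
- by lia.
by rewrite /= subnKC.
Qed.

Section Product.
Variable mu : 2.-tuple M -> M.
Hypothesis alg_mu : graded_assoc_alg mu.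

(** The binary product in suspended form. *)
Definition smul x y := susp mu [:: x; y].

Lemma smulE x y : smul x y = mu [tuple eps x; y].
Proof. exact: (tapp_tuple mu [tuple eps x; y]). Qed.

Lemma mlin_mu : mlin (susp mu).
Proof. by case: alg_mu => -[lmu _] _; exact: mlin_susp. Qed.

Lemma sdegree_mu : sdegree 2 (susp mu).
Proof. by case: alg_mu => -[_ dmu] _; exact: sdegree_susp. Qed.

Lemma smulDl : left_distributive smul +%R.
Proof. by move=> x y z; exact: (mlinD [::] [:: z] _ _ mlin_mu). Qed.

Lemma smulDr : right_distributive smul +%R.
Proof. by move=> x y z; exact: (mlinD [:: x] [::] _ _ mlin_mu). Qed.

Lemma smul0l x : smul 0 x = 0.
Proof. exact: (mlin0 [::] [:: x] mlin_mu). Qed.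

Lemma smul0r x : smul x 0 = 0.
Proof. exact: (mlin0 [:: x] [::] mlin_mu). Qed.

Lemma smulNl x y : smul (- x) y = - smul x y.
Proof. exact: (mlinN [::] [:: y] x mlin_mu). Qed.

Lemma smulZl k x y : smul (k *: x) y = k *: smul x y.
Proof. exact: (mlinZ [::] [:: y] k x mlin_mu). Qed.

Lemma smulZr k x y : smul x (k *: y) = k *: smul x y.
Proof. exact: (mlinZ [:: x] [::] k y mlin_mu). Qed.

(** Associativity in suspended form acquires the sign of the passage of the
    odd product over x, and so becomes the A-infinity relation for mu. *)
Lemma smul_assoc x y z : smul (smul x y) z + smul (sg x) (smul y z) = 0.
Proof.
have [_ assoc] := alg_mu.
have eps_mul : eps (smul x y) = mu [tuple x; eps y].
  have := map_sg [:: x; y] mlin_mu (sdegree_mu : sdegree 2%N _).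
  rewrite sqrrN expr1n scale1r => <- /=; rewrite -/(smul _ _) /sg.
  by rewrite -!scaleN1r smulZl smulZr scalerA mulrNN mulr1 scale1r smulE epsK.
rewrite smulE eps_mul /sg smulNl !smulE epsK.
by have := assoc x (eps y) z; rewrite /= => ->; rewrite subrr.
Qed.

Lemma bar_mu_cons2 s (F : seq M -> M) x y a : mlin F ->
  bar s (susp mu) F (x :: y :: a) =
  F (smul x y :: a) + bar s (susp mu) (fun b => F (s x :: b)) (y :: a).
Proof.
move=> lF; rewrite [LHS]/=; congr (_ + _).
rewrite (splitsum_first (x := y)) // => b c _ b1.
by rewrite susp_out ?(mlin0 [::] _ lF) // => -[] /eqP; rewrite (negPf b1).
Qed.

Lemma bar_mu1 s (F : seq M -> M) x : mlin F -> bar s (susp mu) F [:: x] = 0.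
Proof. by move=> lF; rewrite /= splitsum_nil susp_out // (mlin0 [::] _ lF) addr0. Qed.

Lemma insertion_hochE n (f : n.-tuple M -> M) F (a : n.+1.-tuple M) :
  (forall t, f t = F (tw t)) -> mlin F ->
  \sum_(1 <= i < n.+1)
      (-1) ^+ i *: comp_tens f (insertion i.-1 (GMap 0 mu) (n - i)) a =
  - bar sg (susp mu) F (tw a).
Proof.
move=> fF lF; rewrite bar_sum size_tw size_tuple big_add1 big_mkord.
pose term r l := F (map sg (take r (tw a)) ++
  susp mu (take l (drop r (tw a))) :: drop (r + l) (tw a)).
have inner r : \sum_(l < n.+2 | (r + l <= n.+1)%N && (0 < l)%N) term r l =
    if (r < n)%N then term r 2%N else 0.
  have z0 (l : 'I_n.+2) : (r + l <= n.+1)%N -> val l != 2 -> term r l = 0.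
    move=> rl l2; rewrite /term susp_out ?mlin0 // size_takel; first exact/eqP.
    by rewrite size_drop size_tw size_tuple; lia.
  case: ifP => rn; last first.
    apply: big1 => l /andP[rl _]; apply: z0 => //; apply/eqP => l2.
    by move: rl; rewrite l2; lia.
  have l2 : (2 < n.+2)%N by lia.
  rewrite (bigD1 (Ordinal l2)) /=; last by lia.
  rewrite big1 ?addr0 // => l /andP[/andP[rl _] lN2]; exact: z0.
under [X in _ = - X]eq_bigr => r _ do rewrite inner.
rewrite !big_ord_recr /= ltnn ltnNge leqnSn /= !addr0 -sumrN.
apply: eq_bigr => r _; rewrite ltn_ord.
have -> : (-1) ^+ r.+1 = - ((-1) ^+ (r + 2 * (n - r.+1))) :> R.
  by rewrite -[RHS]mulN1r -exprS; apply: eq_signr; lia.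
rewrite scaleNr; congr (- _).
apply: (@comp_insertion _ _ _ _ F (susp mu)) => //.
- by move=> v; rewrite /susp twK tapp_tuple.
- exact: mlin_mu.
- exact: sdegree_mu.
- by have := ltn_ord r; lia.
- by have := ltn_ord r; lia.
Qed.

(** In suspended form the signs of the Hochschild coboundary lose their
    dependence on the arity: the inner terms have a fixed sign, and those of the
    two outer terms depend on the parity of c alone. *)
Lemma hoch_deltaE (c n : nat) (f : n.-tuple M -> M) F (a : n.+1.-tuple M) x y b d :
  (forall t, f t = F (tw t)) -> mlin F -> sdegree c F ->
  tw a = x :: b -> tw a = rcons d y ->
  hoch_delta mu (c%:Z - n%:Z) f a =
  smul (iter c.+1 eps x) (F b) + (-1) ^+ c.+1 *: smul (F d) y
  - bar sg (susp mu) F (tw a).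
Proof.
move=> fF lF dF bE dE; rewrite /hoch_delta (insertion_hochE _ fF lF) addrAC.
have sb : size b = n.
  by have := size_tw a; rewrite bE size_tuple => -[].
have sd : size d = n.
  by have := size_tw a; rewrite dE size_rcons size_tuple => -[].
rewrite /comp_tens; congr (_ + _ - _).
  have -> : tval a = iter n eps x :: tw b by rewrite -[tval a]twK bE /= sb.
  rewrite /= take0 drop0 big_cons big_nil map_ksign0.
  rewrite take_oversize ?size_tw ?sb // (tapp_tw fF) ?size_tw // twK.
  rewrite tapp_gid /smul /susp /=.
  congr (tapp _ [:: _; _]); rewrite ksignE -iterD -!iterS.
  by apply: eq_iter_eps; lia.
have -> : tval a = map eps (tw d) ++ [:: y].
  by rewrite -[tval a]twK dE -cats1 tw_cat.
rewrite /= big_cons big_nil !map_ksign0.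
rewrite take_size_cat ?drop_size_cat ?size_map ?size_tw //.
rewrite (tapp_tw fF) ?size_map ?size_tw // (tw_map_iter 1) twK.
rewrite (map_iter_eps 1 _ lF dF) sd mul1n.
rewrite tapp_gid /=.
have ltm : mlin (tapp mu) by case: alg_mu => -[/mlin_tapp].
rewrite (mlinZ [::] _ _ _ ltm) /= scalerA -exprD; congr (_ *: _).
by apply: eq_signr; lia.
Qed.

Lemma bar_mu_mu b : bar sg (susp mu) (susp mu) b = 0.
Proof.
have lc x := mlin_cons x mlin_mu.
case: b => [|x [|y [|z [|w b]]]] //.
- by rewrite bar_mu1 //; exact: mlin_mu.
- by rewrite bar_mu_cons2 ?bar_mu1 ?susp_out ?addr0 //; exact: mlin_mu.
- rewrite !bar_mu_cons2 //; last exact: mlin_mu.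
  rewrite bar_mu1; last exact: (mlin_cons _ (lc _)).
  by rewrite addr0; exact: smul_assoc.
apply: bar0 => c d e E _; have [d2|d2] := eqVneq (size d) 2%N.
  rewrite susp_out // size_cat /= size_map => E2.
  by have := congr1 size E; rewrite !size_cat /=; lia.
by rewrite [susp mu d]susp_out ?mlin0 //; [exact: mlin_mu | exact/eqP].
Qed.

Lemma trivial_AinfE i (t : i.-tuple M) : trivial_Ainf mu i t = susp mu (tw t).
Proof.
case: i t => [|[|[|i]]] t /=; last by rewrite susp_out ?size_tw ?size_tuple.
- by rewrite susp_out ?size_tw ?size_tuple.
- by rewrite susp_out ?size_tw ?size_tuple.
by rewrite /susp twK tapp_tuple.
Qed.

Lemma trivial_is_Ainf : is_Ainf (trivial_Ainf mu).
Proof.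
split=> [i _|n _ a].
  exact: (is_Hom_tw (@trivial_AinfE i) mlin_mu sdegree_mu).
rewrite (@insertion_sumE _ _ (susp mu) (susp mu)) ?bar_mu_mu //.
- by move=> i t _; exact: trivial_AinfE.
- by move=> i t _; exact: trivial_AinfE.
- exact: mlin_mu.
- exact: mlin_mu.
- exact: sdegree_mu.
Qed.

(** The letters of the first block pass a map of degree 1 - j and the j
    suspensions of the second block, which leaves one eps; taken out of P,
    at the cost of the sign (-1)^(i - 1), it is the eps in smulE. *)
Lemma comp_mu i j (f : i.-tuple M -> M) (g : j.-tuple M -> M) P n (a : n.-tuple M) :
  (forall t, f t = P (tw t)) -> (forall t, g t = P (tw t)) ->
  mlin P -> sdegree 1 P -> (i + j)%N = n -> (0 < i)%N ->
  (-1) ^+ (i - 1) *: comp_tens mu [:: GMap (1 - i%:Z) f; GMap (1 - j%:Z) g] a =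
  smul (P (take i (tw a))) (P (drop i (tw a))).
Proof.
move=> fP gP lP dP ij i0.
have sb : size (tw a) = n by rewrite size_tw size_tuple.
set b := tw a in sb *.
have sB : size (take i b) = i by rewrite size_takel // sb -ij leq_addr.
have sC : size (drop i b) = j by rewrite size_drop sb -ij addKn.
have aE : tval a = map (iter j eps) (tw (take i b)) ++ tw (drop i b).
  by rewrite -sC -tw_cat cat_take_drop twK.
rewrite /comp_tens aE /= !big_cons !big_nil map_ksign0 addr0.
rewrite take_size_cat ?drop_size_cat ?size_map ?size_tw //.
rewrite (@take_oversize _ j) ?size_tw ?sC // (tapp_tw gP) ?size_tw // twK.
rewrite (tapp_tw fP) ?size_map ?size_tw //.
have -> : map (ksign (1 - j%:Z)) (map (iter j eps) (tw (take i b))) =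
          map (iter 1 eps) (tw (take i b)).
  rewrite -map_comp; apply: eq_map => x; rewrite /= ksignE -iterD.
  by apply: (@eq_iter_eps _ _ _ 1); lia.
rewrite tw_map_iter twK (map_iter_eps 1 _ lP (dP : sdegree 1%N P)) sB mul1n.
have ltm : mlin (tapp mu) by case: alg_mu => -[/mlin_tapp].
rewrite (mlinZ [::] _ _ _ ltm) /= scalerA -exprD -[RHS]scale1r; congr (_ *: _).
by apply: (@eq_signr _ _ 0); lia.
Qed.

(** The right-hand side of the morphism equation reduces to its terms with
    u = 2, and these form the convolution square of P. The condition P [::] = 0
    accounts for the blocks being nonempty. *)
Lemma trivial_compE (p : forall i : nat, i.-tuple M -> M) P n (a : n.-tuple M) :
  (forall i (t : i.-tuple M), p i t = P (tw t)) ->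
  mlin P -> sdegree 1 P -> P [::] = 0 -> (1 <= n)%N ->
  \sum_(1 <= u < n.+1)
      \sum_(k : u.-tuple 'I_n.+1 |
              (\sum_(l < u) tnth k l == n)%N
              && [forall l : 'I_u, (1 <= tnth k l)%N])
        (-1) ^+ (\sum_(l < u) (u - l.+1) * (tnth k l - 1))%N *:
          comp_tens (trivial_Ainf mu u)
            [seq GMap (1 - (val j)%:Z) (p (val j)) | j : 'I_n.+1 <- k] a
  = splitsum (fun b c => smul (P b) (P c)) (tw a).
Proof.
move=> pP lP dP P0 n1.
have tapp0 u b : tapp (fun _ : u.-tuple M => 0 : M) b = 0.
  by rewrite /tapp; case: insub.
have [n2|n2] := leqP n 1.
  have {n1 n2} n1 : n = 1%N by lia.
  subst n; rewrite big_nat1 big1 => [|k _]; last by rewrite /comp_tens tapp0 scaler0.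
  have := size_tw a; rewrite size_tuple; case: (tw a) => [|x [|]] // _.
  by rewrite splitsum_cons splitsum_nil P0 smul0l smul0r addr0.
rewrite (bigD1_seq 2%N) /= ?mem_index_iota ?iota_uniq ?n2 //.
rewrite [X in _ + X]big1 ?addr0 => [|u u2]; last first.
  apply: big1 => k _; case: u k u2 => [|[|[|u]]] k //= _;
  by rewrite /comp_tens tapp0 scaler0.
have tup_bij : bijective (fun ij : 'I_n.+1 * 'I_n.+1 => [tuple ij.1; ij.2]).
  exists (fun k => (tnth k ord0, tnth k (lift ord0 ord0))) => [[i j] //|k].
  by apply: eq_from_tnth => l; rewrite !(tnth_nth ord0); case: l => [[|[|]]].
rewrite big_mkcond (reindex _ (onW_bij _ tup_bij)) /=.
pose G (i j : 'I_n.+1) := if [&& i + j == n, 0 < i & 0 < j]%N then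
  (-1) ^+ (i - 1) *: comp_tens mu
    [:: GMap (1 - (val i)%:Z) (p (val i)); GMap (1 - (val j)%:Z) (p (val j))] a
  else 0.
rewrite (eq_bigr (fun q => G q.1 q.2)) => [|[i j] _ /=]; last first.
  rewrite !big_ord_recl !big_ord0 /= !(tnth_nth ord0) /= !addn0 mul1n.
  rewrite /G; congr (if _ then _ else _); congr (_ && _).
  apply/forallP/andP => [h|[i0 j0] [[|[|l]] lt2]] //.
  by split; [exact: (h ord0) | exact: (h (lift ord0 ord0))].
have sb : size (tw a) = n by rewrite size_tw size_tuple.
rewrite -(pair_bigA _ G) /splitsum sb; apply: eq_bigr => i _.
have ni : (n - i < n.+1)%N by rewrite ltnS leq_subr.
rewrite (bigD1 (Ordinal ni)) //= [X in _ + X]big1 ?addr0 => [|j /eqP jN].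
  have le_in : (i <= n)%N by rewrite -ltnS.
  rewrite /G [nat_of_ord (Ordinal ni)]/= subnKC // eqxx subn_gt0 andTb.
  case: ifPn => [/andP[i0 lt_in]|].
    by apply: (comp_mu _ _ _ lP dP) => //; rewrite subnKC.
  rewrite negb_and -!leqNgt leqn0 => /orP[/eqP->|ni'].
    by rewrite take0 P0 smul0l.
  by rewrite drop_oversize ?sb // P0 smul0r.
rewrite /G ifF //; apply/negP=> /and3P[/eqP E _ _]; apply: jN; apply: val_inj => /=.
by rewrite -[X in (X - _)%N]E addKn.
Qed.

End Product.
End Bridge.

(** * Obstruction theory *)

Lemma word_ends (T : Type) n (a : seq T) : size a = n.+1 ->
  (exists x b, a = x :: b) /\ (exists d y, a = rcons d y).
Proof.
case: a => // x b _; split; first by exists x, b.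
by exists (belast x b), (last x b); exact: lastI.
Qed.

Section Obstruction.
Variables (R : comNzRingType) (M : gradedMod R) (mu : 2.-tuple M -> M).
Hypothesis alg_mu : graded_assoc_alg mu.
Variable m : forall i : nat, i.-tuple M -> M.
Hypothesis Ainf_m : is_Ainf m.
Hypothesis m1 : forall a : 1.-tuple M, m a = 0.
Hypothesis m2 : forall a : 2.-tuple M, m a = mu a.
Implicit Types (x y : M) (a b c : seq M) (F G P Q : seq M -> M).

Local Notation smul := (smul mu).


(** The whole family of operations as one function of words. The value on the
    empty word is 0, so that it has degree 2 whatever m_0 is. *)
Definition barop b : M := if nilp b then 0 else susp (@m (size b)) b.

Lemma baropE i (t : i.-tuple M) : (0 < i)%N -> m t = barop (tw t).
Proof.
move=> i0; rewrite /barop /nilp size_tw size_tuple -[i == 0%N]negbK -lt0n i0 /=.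
by rewrite /susp twK tapp_tuple.
Qed.

Lemma mlin_barop : mlin barop.
Proof.
move=> b c k x y; rewrite /barop /nilp !size_cat /= !addnS /=.
case: Ainf_m => Hom_m _; case: (Hom_m (size b + size c).+1) => // lm _.
exact: mlin_susp.
Qed.

Lemma sdegree_barop : sdegree 2 barop.
Proof.
move=> a D aD; rewrite /barop; case: ifPn => [_|]; first exact: rpred0.
rewrite /nilp -lt0n => a0; case: Ainf_m => Hom_m _; case: (Hom_m (size a)) => // _ dm.
exact: (sdegree_susp dm).
Qed.

Lemma barop1 x : barop [:: x] = 0.
Proof. by rewrite /barop /susp /tapp insubT /= m1. Qed.

Lemma barop2 a : size a = 2%N -> barop a = susp mu a.
Proof.
move=> a2; rewrite /barop /nilp a2 /susp.
have tP : size (tw a) == 2%N by rewrite size_tw a2.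
by rewrite -[tw a]/(tval (Tuple tP)) !tapp_tuple m2.
Qed.

Local Notation D := (bar sg barop).
Local Notation Dmu := (bar sg (susp mu)).

Lemma D_barop a : D barop a = 0.
Proof.
case: a => [|x a] //; case: Ainf_m => _ relm.
have aP : size (tw (x :: a)) == (size a).+1 by rewrite size_tw.
have := relm (size a).+1 isT (Tuple aP).
rewrite (insertion_sumE _ baropE baropE mlin_barop mlin_barop sdegree_barop).
by rewrite -{2}[x :: a]twK.
Qed.

Definition conv P Q a := splitsum (fun b c => smul (P b) (Q c)) a.

(** The failure of P to define a morphism to the trivial structure. *)
Definition defect P a := D P a - conv P P a.

Lemma mlin_conv P Q : mlin P -> mlin Q -> mlin (conv P Q).
Proof.
move=> lP lQ; apply: mlin_splitsum => [c|b] b' c' k x y /=.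
  by rewrite lP (smulDl alg_mu) (smulZl alg_mu).
by rewrite lQ (smulDr alg_mu) (smulZr alg_mu).
Qed.

Lemma mlin_defect P : mlin P -> mlin (defect P).
Proof.
move=> lP; apply: mlin_add; last exact/mlin_opp/mlin_conv.
exact: (mlin_bar (@sg_lin R M) mlin_barop lP).
Qed.

Lemma sdegree_defect P : sdegree 1 P -> sdegree 2 (defect P).
Proof.
move=> dP a E aE; apply: rpredD; first exact: (sdegree_bar sdegree_barop dP).
apply: homogN; apply: rpred_sum => i _.
move: aE; rewrite -{1}(cat_take_drop i a) => /homw_cat[E1 [E2 [h1 h2 ->]]].
have := sdegree_mu alg_mu (homw_cons (dP _ _ h1) (homw_cons (dP _ _ h2) (homw_nil M))).
by apply: etrans; congr (_ \in homog M _); ring.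
Qed.

(** As the operations never lengthen a word, the defect on a word depends only
    on words that are not longer. *)
Lemma defect_local P Q a :
  (forall b, (size b <= size a)%N -> P b = Q b) -> defect P a = defect Q a.
Proof.
move=> PQ; congr (_ - _).
  apply: eq_bar => b c e E c0; apply: PQ.
  by rewrite E !size_cat /= size_map; lia.
by apply: eq_splitsum => b c E; rewrite !PQ // E size_cat ?leq_addl ?leq_addr.
Qed.

(** The convolution product is associative up to the sign in smul_assoc. *)
Lemma conv_assoc P Q S a :
  (forall b, P (map sg b) = sg (P b)) ->
  conv (conv P Q) S a + conv (fun b => P (map sg b)) (conv Q S) a = 0.
Proof.
move=> sP; rewrite /conv.
have -> : splitsum (fun b c =>
      smul (P (map sg b)) (splitsum (fun b c => smul (Q b) (S c)) c)) a =
    splitsum (fun b c =>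
      splitsum (fun b' c' => smul (sg (P b)) (smul (Q b') (S c'))) c) a.
  apply: eq_splitsum => b c _; rewrite sP.
  symmetry.
  apply: (@splitsum_morph _ _ _ (smul _) (fun b c => smul (Q b) (S c))).
    exact: smul0r.
  exact: smulDr.
rewrite splitsumA -splitsumD splitsum0 // => b c _.
rewrite -(@splitsum_morph _ _ _ (fun x => smul x (S c)) (fun b c => smul (P b) (Q c))).
- by rewrite -splitsumD splitsum0 // => b' c' _; exact: smul_assoc.
- exact: smul0l.
by move=> x y; exact: smulDl.
Qed.

(** The Bianchi identity for the defect, which is the curvature of P. *)
Lemma D_defect P a : mlin P -> sdegree 1 P ->
  D (defect P) a + conv (defect P) P a +
    conv (fun b => P (map sg b)) (defect P) a = 0.
Proof.
move=> lP dP.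
have sP b : P (map sg b) = sg (P b).
  by rewrite (map_sg _ lP (dP : sdegree 1%N P)) expr1 scaleN1r.
have mD : forall b, barop (map sg b) = - sg (barop b).
  move=> b; rewrite (map_sg _ mlin_barop (sdegree_barop : sdegree 2%N _)).
  by rewrite sqrrN expr1n scale1r opprK.
have E b : D P b = defect P b + conv P P b by rewrite subrK.
rewrite barD barN (bar_bar _ (@sgK R M) mD lP D_barop) add0r.
rewrite [X in - X](_ : _ =
    conv (D P) P a + conv (fun b => P (map sg b)) (D P) a); last first.
  rewrite /conv bar_splitsum splitsumD; congr (_ + _); apply: eq_splitsum => b c _.
    rewrite (@bar_morph _ _ _ _ (fun x => smul x (P c))) //; first exact: smul0l.
    by move=> x y; exact: smulDl.
  by rewrite (@bar_morph _ _ _ _ (smul _)) //; [exact: smul0r | exact: smulDr].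
rewrite [conv (D P) P a](_ : _ = conv (defect P) P a + conv (conv P P) P a); last first.
  by rewrite -splitsumD; apply: eq_splitsum => b c _; rewrite E; exact: smulDl.
rewrite [conv _ (D P) a](_ : _ = conv (fun b => P (map sg b)) (defect P) a +
    conv (fun b => P (map sg b)) (conv P P) a); last first.
  by rewrite -splitsumD; apply: eq_splitsum => b c _; rewrite E; exact: smulDr.
rewrite addrACA (conv_assoc _ _ _ sP) addr0 opprD.
by rewrite -addrA -opprD addNr.
Qed.

(** On the shortest words where it does not vanish for reasons of arity, the
    bar differential sees only the product: m_1 = 0, and inserting m_3 or a
    higher operation shortens the word to a length where F is zero. *)
Lemma D_lead F N a : mlin F -> (forall b, (size b < N)%N -> F b = 0) ->
  (size a <= N.+1)%N -> D F a = Dmu F a.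
Proof.
move=> lF F0 aN; apply: eq_bar => b [|x [|y [|z c]]] e E // _.
- by rewrite barop1 susp_out.
- by rewrite barop2.
have sE := congr1 size E; rewrite !size_cat /= in sE.
by rewrite !F0 // size_cat /= size_map; lia.
Qed.

(** Approximate solutions that start with the identity. The component in arity
    n of P does not enter the defect on words of length n or less, so that it is
    still free to be changed. *)
Record approx n P : Prop := Approx {
  approx_mlin : mlin P;
  approx_deg : sdegree 1 P;
  approx_nil : P [::] = 0;
  approx1 : forall x, P [:: x] = x;
  approx_defect : forall a, (size a <= n)%N -> defect P a = 0
}.

(** The identity alone is exact up to arity 2, because m_2 = mu. *)
Lemma approx_start : approx 2 (fun b => if b is [:: x] then x else 0).
Proof.
have l1 : mlin (fun b : seq M => if b is [:: x] then x else 0).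
  by move=> [|z [|w b]] [|z' c] k x y //=; rewrite scaler0 addr0.
split=> //.
  move=> [|x [|y a]] E h; rewrite ?rpred0 //.
  have [q [E' [xq hE ->]]] := homw_consE h.
  have -> : E' = 0 by inversion hE.
  by rewrite addr0 subrK.
move=> [|x [|y [|z a]]] // _; rewrite /defect /conv.
- by rewrite splitsum_nil [smul _ _](smul0l alg_mu) subr0.
- rewrite (D_lead (N := 0)) // bar_mu1 // splitsum_cons splitsum_nil.
  by rewrite [smul _ x](smul0l alg_mu) [smul x _](smul0r alg_mu) addr0 subr0.
rewrite (D_lead (N := 1)) //; last by case.
rewrite bar_mu_cons2 // bar_mu1 ?addr0; last exact: (mlin_cons (sg x) l1).
rewrite !splitsum_cons splitsum_nil.
by rewrite !smul0l // add0r addr0; exact: subrr.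
Qed.

(** On words of length n + 2, each term of D_defect involves the defect in
    arity n + 1 only, and the other factor of each product is a single letter. *)
Lemma defect_cocycle n P : approx n P -> (2 <= n)%N ->
  hoch_cocycle mu (2 - n.+1%:Z) (fun t : n.+1.-tuple M => defect P (tw t)).
Proof.
case=> lP dP P0 P1 dP0 n2.
have lF := mlin_defect lP; have dF := sdegree_defect dP.
split; first exact: (is_Hom_tw _ lF dF).
move=> a; have sa := size_tw a; rewrite size_tuple in sa.
have [[x [b bE]] [d [y dE]]] := word_ends sa.
have sb : size b = n.+1 by move: sa; rewrite bE => -[].
have sd : size d = n.+1 by move: sa; rewrite dE size_rcons => -[].
rewrite (hoch_deltaE alg_mu (c := 2) _ lF dF bE dE) //.
have := D_defect (tw a) lP dP.
rewrite (D_lead (N := n.+1) lF); first last.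
- by rewrite size_tw size_tuple.
- by move=> c cn; apply: dP0.
rewrite {2}dE {2}bE /conv splitsum_last => [|c e E eN]; last first.
  have := congr1 size E; rewrite size_rcons sd size_cat => sE.
  case: e {E} eN sE => [|z e] /= eN sE; first by rewrite P0; exact: smul0r.
  by rewrite dP0; [exact: smul0l | lia].
rewrite splitsum_first => [|c e E cN]; last first.
  have := congr1 size E; rewrite /= sb size_cat => sE.
  case: c {E} cN sE => [|z c] /= cN sE; first by rewrite P0; exact: smul0l.
  by rewrite dP0; [exact: smul0r | lia].
rewrite /= !P1 epsK => E0.
have -> : smul (eps x) (defect P b) = - smul (sg x) (defect P b).
  by rewrite /sg smulNl // opprK.
rewrite -signr_odd /= expr1 scaleN1r -opprD -opprD.
apply/eqP; rewrite oppr_eq0; apply/eqP; rewrite -[RHS]E0.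
by rewrite -addrA [RHS]addrC; congr (_ + _); exact: addrC.
Qed.

(** A primitive g of the obstruction is added to P in arity n. Its contribution
    to the defect in arity n + 1 is minus its Hochschild coboundary, since m_3
    and higher operations inserted into g, and products of g with itself or with
    components of P other than the identity, only show in higher arities. *)
Lemma approx_step n P : approx n P -> (2 <= n)%N ->
  hoch_eq0 mu n.+1 (2 - n.+1%:Z) ->
  exists Q, approx n.+1 Q /\ (forall a, size a <> n -> Q a = P a).
Proof.
move=> aP n2 /(_ _ (defect_cocycle aP n2)) [g].
have -> : 2 - n.+1%:Z = 1 - n%:Z by lia.
case=> lg dg gE; case: aP => lP dP P0 P1 dP0.
pose G := susp g.
have lG : mlin G := mlin_susp lg.
have dG : sdegree 1 G := sdegree_susp dg.
have G0 a : size a <> n -> G a = 0 by exact: susp_out.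
have gG t : g t = G (tw t) by rewrite /G /susp twK tapp_tuple.
exists (fun a => P a + G a); split; last by move=> a /G0->; rewrite addr0.
have convE a : conv (fun b => P b + G b) (fun b => P b + G b) a =
    conv P P a + (conv P G a + conv G P a) + conv G G a.
  rewrite /conv -!splitsumD; apply: eq_splitsum => b c _.
  by rewrite [smul _ _](smulDl alg_mu) !(smulDr alg_mu) -!addrA; congr (_ + (_ + _)).
split=> [||||a an].
- exact: mlin_add.
- by move=> a E aE; apply: rpredD; [exact: dP | exact: dG].
- by rewrite P0 G0 ?addr0 //=; lia.
- by move=> x; rewrite P1 G0 ?addr0 //=; lia.
(* A product of G with itself has arity 2 n, which exceeds n + 1. *)
have GG : conv G G a = 0.
  rewrite /conv splitsum0 // => b c E.
  have sE := congr1 size E; rewrite size_cat in sE.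
  have [bn|bn] := eqVneq (size b) n; last by rewrite G0; [exact: smul0l | exact/eqP].
  by rewrite [G c]G0; [exact: smul0r | lia].
rewrite /defect barD convE GG addr0 opprD addrACA -/(defect P a).
rewrite (D_lead (N := n) lG) //; last by move=> b bn; apply: G0; lia.
have [lt_an|le_na] := leqP (size a) n.
  rewrite dP0 // add0r bar0 => [|b c e E _]; last first.
    have sE := congr1 size E; rewrite !size_cat in sE.
    have [c2|/eqP cN2] := eqVneq (size c) 2%N; last by rewrite susp_out ?mlin0.
    by apply: G0; rewrite size_cat /= size_map; lia.
  have PG : conv P G a = 0.
    apply: splitsum0 => b c E; have sE := congr1 size E; rewrite size_cat in sE.
    case: b {E} sE => [|z b] /= sE; first by rewrite P0; exact: smul0l.
    by rewrite G0; [exact: smul0r | lia].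
  have GP : conv G P a = 0.
    apply: splitsum0 => b c E; have sE := congr1 size E; rewrite size_cat in sE.
    case: c {E} sE => [|z c] /= sE; first by rewrite P0; exact: smul0r.
    by rewrite G0; [exact: smul0l | lia].
  by rewrite PG GP addr0 subr0.
have sa : size a = n.+1 by lia.
have aP : size (tw a) == n.+1 by rewrite size_tw sa.
have := gE (Tuple aP); rewrite [tval _]/(tw a) twK.
have [[x [b bE]] [d [y dE]]] := word_ends sa.
have sb : size b = n by move: sa; rewrite bE => -[].
have sd : size d = n by move: sa; rewrite dE size_rcons => -[].
have bE' : tw (Tuple aP) = x :: b by rewrite [tval _]/(tw a) twK.
have dE' : tw (Tuple aP) = rcons d y by rewrite [tval _]/(tw a) twK.
rewrite (hoch_deltaE alg_mu (c := 1) gG lG dG bE' dE') [tval _]/(tw a) twK => ->.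
have -> : conv P G a = smul x (G b).
  rewrite bE /conv splitsum_first ?P1 // => e c E eN.
  have sE := congr1 size E; rewrite /= sb size_cat in sE.
  case: e {E} eN sE => [|z e] /= eN sE; first by rewrite P0; exact: smul0l.
  by rewrite G0; [exact: smul0r | lia].
have -> : conv G P a = smul (G d) y.
  rewrite dE /conv splitsum_last ?P1 // => e c E cN.
  have sE := congr1 size E; rewrite size_rcons sd size_cat in sE.
  case: c {E} cN sE => [|z c] /= cN sE; first by rewrite P0; exact: smul0r.
  by rewrite G0; [exact: smul0l | lia].
rewrite /= epsK sqrrN expr1n scale1r.
by rewrite -[X in _ + X]opprB subrr.
Qed.

Section Limit.
Hypothesis hoch0 : forall n : nat, (3 <= n)%N -> hoch_eq0 mu n (2 - n%:Z).

(** The approximation of index k differs from the next one only in arity k + 2,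
    so on a given word the sequence becomes constant; the limit takes the value
    of the approximation whose index is the length of the word. *)
Lemma approx_limit : exists P, forall n, approx n P.
Proof.
have step n (s : {P | approx n.+2 P}) :
    {Q | approx n.+3 Q /\ forall a, size a <> n.+2 -> Q a = sval s a}.
  apply: constructive_indefinite_description.
  exact: approx_step (svalP s) _ (hoch0 _).
pose next n s := exist (approx n.+3) (sval (step n s)) (proj1 (svalP (step n s))).
pose fix chain n : {P | approx n.+2 P} :=
  if n is n'.+1 then next n' (chain n') else exist _ _ approx_start.
have stable a n k : (size a < n.+2)%N -> sval (chain (k + n)) a = sval (chain n) a.
  move=> an; elim: k => //= k <-; rewrite (proj2 (svalP (step (k + n)%N _))) //; lia.
pose P a := sval (chain (size a)) a.
have PE a n : (size a <= n)%N -> P a = sval (chain n) a.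
  by move=> an; rewrite -(subnK an) stable //; lia.
have approxP n := svalP (chain n).
exists P => n; split.
- move=> b c k x y; pose N := size (b ++ x :: c).
  have sN z : (size (b ++ z :: c) <= N)%N by rewrite /N !size_cat.
  rewrite !(PE _ _ (sN _)); exact: (approx_mlin (approxP N)).
- by move=> a; exact: (approx_deg (approxP (size a))).
- exact: (approx_nil (approxP 0%N)).
- exact: (approx1 (approxP 1%N)).
move=> a _; rewrite (@defect_local _ (sval (chain (size a)))) => [|b]; last exact: PE.
by apply: (approx_defect (approxP _)); lia.
Qed.

End Limit.
End Obstruction.

(** * Triviality of the A-infinity structure *)

Theorem corollary4 (K : fieldType) (M : gradedMod K) (mu : 2.-tuple M -> M)
  (alg_mu : graded_assoc_alg mu)
  (hoch0 : forall n : nat, (3 <= n)%N -> hoch_eq0 mu n (2 - n%:Z))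
  (m : forall i : nat, i.-tuple M -> M)
  (Ainf_m : is_Ainf m)
  (m1 : forall a : 1.-tuple M, m 1%N a = 0)
  (m2 : forall a : 2.-tuple M, m 2%N a = mu a) :
  Ainf_equiv mu m (trivial_Ainf mu).
Proof.
have [P aP] := approx_limit alg_mu Ainf_m m1 m2 hoch0.
have [lP dP P0 P1 _] := aP 0%N.
split=> //; first by split=> //; exact: trivial_is_Ainf.
exists (fun i t => P (tw t)); split=> [|x]; last exact: P1.
split=> [i _|n n1 a]; first exact: (is_Hom_tw _ lP dP).
rewrite (trivial_compE alg_mu (p := fun i t => P (tw t)) a (P := P)) //.
rewrite (insertion_sumE _ (F := P) (mt := barop m)) //.
- by apply/eqP; rewrite -subr_eq0; apply/eqP; exact: (approx_defect (aP _) (leqnn _)).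
- by move=> i t i0; exact: baropE.
- exact: (mlin_barop Ainf_m).
exact: (sdegree_barop Ainf_m).
Qed.
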